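(* Let $f_{ax\_kite}(n)$ denote the maximum size of a point set $P\subseteq[1,n]\times[1,n]$ such that $P$ does not contain (the vertex set of) a kite having horizontal and vertical diagonals. Then $$f_{ax\_kite}(n)=\Omega\left(\frac{n^2}{e^{O(\sqrt{\log n})}}\right),$$ that is, there exist constants $c,C>0$ such that $f_{ax\_kite}(n)\ge c\,n^2 e^{-C\sqrt{\log n}}$ for all sufficiently large integers $n$.
   Context: Here $[1,n]=\{1,2,\dots,n\}$ is an integer interval, so $[1,n]\times[1,n]$ is the $n\times n$ integer grid in the Euclidean plane. A kite is a non-degenerate quadrilateral (four distinct vertices, no three collinear) that is symmetric about the line of one of its diagonals; rhombuses and squares are kites. The kites considered are those for which one diagonal is horizontal and the other is vertical. *)

(* Defs.v *)
From mathcomp Require Import all_boot all_order all_algebra.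

Set Implicit Arguments.
Unset Strict Implicit.
Unset Printing Implicit Defensive.

Import Order.TTheory GRing.Theory Num.Theory.
Local Open Scope ring_scope.

Section Kite.
Variable R : realFieldType.
Implicit Types A B C D X : R * R.

Definition collinear A B C : bool :=
  (B.1 - A.1) * (C.2 - A.2) == (B.2 - A.2) * (C.1 - A.1).

(* Orthogonal reflection of X across the line AC: X |-> 2 H - X, where
   H = A + t (C - A) is the foot of the perpendicular from X.
   It is only meaningful when A != C. *)
Definition reflection A C X : R * R :=
  let t := ((X.1 - A.1) * (C.1 - A.1) + (X.2 - A.2) * (C.2 - A.2))
           / ((C.1 - A.1) ^+ 2 + (C.2 - A.2) ^+ 2) in
  (2 * (A.1 + t * (C.1 - A.1)) - X.1,
   2 * (A.2 + t * (C.2 - A.2)) - X.2).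

(* A, B, C, D are the vertices in cyclic order, so the diagonals are AC, BD. *)
Definition nondegenerate A B C D : bool :=
  [&& uniq [:: A; B; C; D], ~~ collinear A B C, ~~ collinear A B D,
      ~~ collinear A C D & ~~ collinear B C D].

(* The quadrilateral ABCD is symmetric about the line XY. When XY is one of its
   diagonals, a reflection preserving the vertex set fixes X and Y, hence also
   preserves the pair of diagonals and the four sides. *)
Definition symmetric_about X Y A B C D : bool :=
  perm_eq [seq reflection X Y Z | Z <- [:: A; B; C; D]] [:: A; B; C; D].

Definition kite A B C D : bool :=
  nondegenerate A B C D &&
  (symmetric_about A C A B C D || symmetric_about B D A B C D).

Definition horizontal A B : bool := A.2 == B.2.
Definition vertical A B : bool := A.1 == B.1.

Definition ax_kite A B C D : bool :=
  kite A B C D &&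
  ((horizontal A C && vertical B D) || (vertical A C && horizontal B D)).

Section Grid.
Variable n : nat.

(* 'I_n is {0, ..., n - 1}; the shift by one identifies 'I_n * 'I_n with
   [1, n] x [1, n]. *)
Definition grid_point (p : 'I_n * 'I_n) : R * R := (p.1.+1%:R, p.2.+1%:R).

Definition ax_kite_free (P : {set 'I_n * 'I_n}) : bool :=
  ~~ [exists a in P, exists b in P, exists c in P, exists d in P,
        ax_kite (grid_point a) (grid_point b) (grid_point c) (grid_point d)].

End Grid.

Definition f_ax_kite (n : nat) : nat :=
  (\max_(P : {set 'I_n * 'I_n} | ax_kite_free P) #|P|)%N.

End Kite.

(* Main.v *)
Require Import Defs.
From mathcomp Require Import all_boot all_order all_algebra.
From mathcomp Require Import reals sequences exp.
From mathcomp Require Import zify ring lra.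
Import Order.TTheory GRing.Theory Num.Theory.
Local Open Scope ring_scope.

Set Implicit Arguments.
Unset Strict Implicit.
Unset Printing Implicit Defensive.

(** If [S] has no nontrivial 3-term arithmetic progression, then [S * S] has no
    kite with axis-parallel diagonals: the two vertices exchanged by the symmetry
    and the intersection of the diagonals project onto such a progression in the
    coordinate orthogonal to the axis. For [S] take Behrend's set: the integers
    whose [k] base-[2m] digits are below [m] and form a vector on a sphere.
    With [m = 2^(k-1)] and [2^(k^2) <= n < 2^((k+1)^2)] its size is at least
    [n / 2^(6k+1)]. *)

Definition ap3_free (n : nat) (S : {set 'I_n}) : Prop :=
  {in S & &, forall x y z : 'I_n, (x + z = 2 * y)%N -> x = z}.

(** * Positional expansions in base [B] *)

Lemma digits_inj (B d : nat) (a b : nat -> nat) :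
  (forall i, a i < B)%N -> (forall i, b i < B)%N ->
  (\sum_(i < d) a i * B ^ i = \sum_(i < d) b i * B ^ i)%N ->
  forall i, (i < d)%N -> a i = b i.
Proof.
elim: d a b => [//|d IH] a b ha hb.
rewrite !big_ord_recl /= !expn0 !muln1.
have shift (u : nat -> nat) : (\sum_(i < d) u (bump 0 i) * B ^ bump 0 i =
    (\sum_(i < d) u i.+1 * B ^ i) * B)%N.
  by rewrite big_distrl; apply: eq_bigr => i _; rewrite /bump add1n expnSr mulnA.
rewrite !shift => E.
have B0 : (0 < B)%N := leq_ltn_trans (leq0n _) (ha 0%N).
(* Modulo [B] only the lowest digit survives. Once it is cancelled, division by [B] leaves the
   shifted digit sequences. *)
have E0 : a 0%N = b 0%N.
  have := congr1 (modn^~ B) E.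
  by rewrite /= addnC modnMDl addnC modnMDl !modn_small.
move: E; rewrite E0 => /addnI /eqP; rewrite eqn_pmul2r // => /eqP E.
case=> [//|i]; rewrite ltnS => hi.
exact: (IH (fun i => a i.+1) (fun i => b i.+1)).
Qed.

Lemma digits_lt (B d : nat) (a : 'I_d -> nat) :
  (forall i, a i < B)%N -> (\sum_(i < d) a i * B ^ i < B ^ d)%N.
Proof.
elim: d a => [|d IH] a ha; first by rewrite big_ord0.
rewrite big_ord_recr /=.
have h1 : (\sum_(i < d) a (widen_ord (leqnSn d) i) * B ^ i < B ^ d)%N.
  exact: (IH (fun i => a (widen_ord _ i))).
have h2 : (a ord_max * B ^ d <= B.-1 * B ^ d)%N.
  by rewrite leq_mul2r; have := ha ord_max; lia.
have B0 : (0 < B)%N := leq_ltn_trans (leq0n _) (ha ord_max).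
have E : (B * B ^ d = B.-1 * B ^ d + B ^ d)%N.
  by rewrite -{1}(prednK B0) mulSn addnC.
by rewrite expnS E addnC -addnS leq_add.
Qed.

(** * Behrend's sets without three-term progressions *)

Section Behrend.
Variables (m d : nat).

Definition encode (f : {ffun 'I_d -> 'I_m}) : nat :=
  (\sum_(i < d) f i * (2 * m) ^ i)%N.

Definition sqnorm (f : {ffun 'I_d -> 'I_m}) : nat := (\sum_(i < d) f i ^ 2)%N.

(* Sums of two vectors are encoded without carries. *)
Lemma encode_midpoint (f g h : {ffun 'I_d -> 'I_m}) :
  (encode f + encode h = 2 * encode g)%N ->
  forall i, (f i + h i = 2 * g i)%N.
Proof.
move=> E i.
have m0 : (0 < m)%N := leq_ltn_trans (leq0n _) (ltn_ord (f i)).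
(* [digits_inj] wants digits indexed by all of [nat]; out-of-range indices fall back to [i]. Entries
   below [m] keep both sides at most [2 * m - 2], hence valid digits. *)
pose o j := insubd i j.
have oK (j : 'I_d) : o j = j by rewrite /o /insubd valK.
rewrite -(oK i).
apply: (@digits_inj (2 * m) d (fun j => f (o j) + h (o j))%N
  (fun j => 2 * g (o j))%N) => //.
- by move=> j; have := ltn_ord (f (o j)); have := ltn_ord (h (o j)); lia.
- by move=> j; have := ltn_ord (g (o j)); lia.
under eq_bigr => j _ do rewrite oK mulnDl.
under [RHS]eq_bigr => j _ do rewrite oK -mulnA.
by rewrite big_split -big_distrr.
Qed.

(** This is [encode_midpoint] with both endpoints equal to [f]. *)
Lemma encode_inj : injective encode.
Proof.
move=> f g E; apply/ffunP => i; apply/val_inj => /=.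
have := @encode_midpoint f g f; rewrite E => /(_ _ i) H.
by have : (f i + f i = 2 * g i)%N by [apply: H; lia]; lia.
Qed.

Lemma encode_lt f : (encode f < (2 * m) ^ d)%N.
Proof. by apply: digits_lt => i; have := ltn_ord (f i); lia. Qed.

(** Strict convexity of the sphere: expanding the squared norm of [f + h = 2g] gives equality in the
    sum of the inequalities [2 * (f i * h i) <= f i ^ 2 + h i ^ 2], and each of these is an equality
    only if [f i = h i]. *)
Lemma sphere_midpoint (f g h : {ffun 'I_d -> 'I_m}) :
  sqnorm f = sqnorm g -> sqnorm h = sqnorm g ->
  (forall i, f i + h i = 2 * g i)%N -> f = h.
Proof.
move=> Ef Eh mid.
have := @leqif_sum _ predT (fun i => f i == h i) (fun i => 2 * (f i * h i))%N
  (fun i => f i ^ 2 + h i ^ 2)%N (fun i _ => nat_Cauchy (f i) (h i)).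
suff : (\sum_(i < d) 2 * (f i * h i) ==
    \sum_(i < d) (f i ^ 2 + h i ^ 2))%N.
  by move=> + [_ E]; rewrite E => /forallP H; apply/ffunP => i; apply/eqP/H.
rewrite [X in _ == X]big_split -/(sqnorm f) -/(sqnorm h) Ef Eh.
have : (\sum_(i < d) 2 * (f i * h i) + (sqnorm f + sqnorm h)
   = 4 * sqnorm g)%N.
  rewrite /sqnorm -!big_split [RHS]big_distrr; apply: eq_bigr => i _ /=.
  by have := mid i; nia.
by rewrite Ef Eh => E; apply/eqP; move: E => /=; lia.
Qed.

Lemma sqnorm_lt f : (0 < d)%N -> (sqnorm f < d * m ^ 2)%N.
Proof.
move=> d0.
have m0 : (0 < m)%N := leq_ltn_trans (leq0n _) (ltn_ord (f (Ordinal d0))).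
have : (sqnorm f <= \sum_(i < d) m.-1 ^ 2)%N.
  by apply: leq_sum => i _; rewrite leq_exp2r //; have := ltn_ord (f i); lia.
move=> /leq_ltn_trans; apply.
by rewrite sum_nat_const card_ord ltn_pmul2l // ltn_exp2r; lia.
Qed.

(** Pigeonhole: the [m ^ d] vectors are distributed over at most [d * m ^ 2] values of [sqnorm], and
    [r] is the most frequent one. *)
Lemma large_sphere : (0 < d)%N ->
  exists r : nat, (m ^ d <= d * m ^ 2 * #|[set f | sqnorm f == r]|)%N.
Proof.
move=> d0; case: (posnP m) => [m0|m0].
  by exists 0%N; rewrite [X in (X ^ d)%N]m0 exp0n.
have M0 : (0 < d * m ^ 2)%N by rewrite muln_gt0 d0 expn_gt0 m0.
pose F (f : {ffun 'I_d -> 'I_m}) : 'I_(d * m ^ 2) := Ordinal (sqnorm_lt f d0).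
pose r := [arg max_(r > Ordinal M0) #|[set f | F f == r]|].
exists r.
have -> : (m ^ d = \sum_(r < d * m ^ 2) #|[set f | F f == r]|)%N.
  rewrite -{1}(card_ord m) -{1}(card_ord d) -card_ffun -sum1_card.
  rewrite (partition_big F predT) //; apply: eq_bigr => s _.
  by rewrite -sum1_card; apply: eq_bigl => f; rewrite inE.
rewrite -[X in (_ <= X * _)%N](card_ord (d * m ^ 2)) -sum_nat_const; apply: leq_sum => s _.
rewrite /r; case: arg_maxnP => //= t _ /(_ s isT) /leq_trans; apply.
by apply: subset_leq_card; apply/subsetP => f; rewrite !inE.
Qed.

Lemma behrend_digits (n : nat) : (0 < d)%N -> ((2 * m) ^ d <= n)%N ->
  exists S : {set 'I_n}, ap3_free S /\ (m ^ d <= d * m ^ 2 * #|S|)%N.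
Proof.
move=> d0 hn; have [r hr] := large_sphere d0.
pose e f : 'I_n := Ordinal (leq_trans (encode_lt f) hn).
have e_inj : injective e by move=> f g /(congr1 val) /encode_inj.
exists [set e f | f in [set f | sqnorm f == r]]; split.
  move=> _ _ _ /imsetP[f + ->] /imsetP[g + ->] /imsetP[h + ->].
  rewrite !inE => /eqP hf /eqP hg /eqP hh /encode_midpoint mid.
  by congr e; apply: (sphere_midpoint _ _ mid); rewrite ?hf ?hg ?hh.
by rewrite card_imset.
Qed.

End Behrend.

Lemma behrend (k n : nat) : (0 < k)%N -> (2 ^ k ^ 2 <= n < 2 ^ k.+1 ^ 2)%N ->
  exists S : {set 'I_n}, ap3_free S /\ (n <= 2 ^ (6 * k + 1) * #|S|)%N.
Proof.
(* From here [k.+1] is the original [k]: there are [k.+1] digits, and [m = 2 ^ k] makes the base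
   [2 * m = 2 ^ k.+1]. *)
case: k => // k _ /andP[h1 h2].
have [|S [fS hS]] := @behrend_digits (2 ^ k) k.+1 n isT.
  by rewrite -expnS -expnM mulnn.
exists S; split => //; apply: leq_trans (ltnW h2) _.
have -> : (2 ^ k.+2 ^ 2 = 2 ^ (3 * k + 4) * (2 ^ k) ^ k.+1)%N.
  by rewrite -expnM -expnD; congr (_ ^ _)%N; ring.
apply: (leq_trans (leq_mul (leqnn _) hS)).
rewrite mulnA leq_mul2r; apply/orP; right.
(* This bounds the number of radii by [2 ^ (3 * k)]. The total exponent is [6 * k + 4], within the
   allowed [6 * k.+1 + 1]. *)
have k_le : (k.+1 <= 2 ^ k)%N by apply: ltn_expl.
apply: (@leq_trans (2 ^ (3 * k + 4) * (2 ^ k * (2 ^ k) ^ 2))%N).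
  by rewrite leq_mul2l leq_mul2r k_le !orbT.
by rewrite -expnM -!expnD leq_exp2l //; lia.
Qed.

(** * From axis-parallel kites to progressions of coordinates *)

Section KiteGeometry.
Variable R : realFieldType.
Implicit Types A B C D X : R * R.

Lemma reflection_horizontal A C X : A.2 = C.2 -> A.1 != C.1 ->
  reflection A C X = (X.1, 2 * A.2 - X.2).
Proof.
move=> h v; rewrite /reflection -h subrr; congr pair; last by ring.
by field; move: v; lra.
Qed.

Lemma reflection_vertical A C X : A.1 = C.1 -> A.2 != C.2 ->
  reflection A C X = (2 * A.1 - X.1, X.2).
Proof.
move=> h v; rewrite /reflection -h subrr; congr pair; first by ring.
by field; move: v; lra.
Qed.

(** The mirror image of [B] is again a vertex. Since [B] lies off the axis, its image has neither
    the height of [A] and [C] nor that of [B], so it has the height of [D]. *)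
Lemma kite_horizontal_axis A B C D :
  Defs.nondegenerate A B C D -> A.2 = C.2 -> B.1 = D.1 ->
  symmetric_about A C A B C D -> B.2 != D.2 /\ B.2 + D.2 = 2 * A.2.
Proof.
case: A B C D => [a1 a2] [b1 b2] [c1 c2] [d1 d2] /=.
move=> /and5P[U n1 n2 n3 _] hc hd; subst c2 d1; rewrite /symmetric_about.
have ac : a1 != c1.
  by apply: contraNneq n3 => ->; rewrite /collinear /= !subrr !(mul0r, mulr0).
have bd : b2 != d2.
  by apply: contraTneq U => ->; rewrite /= !inE eqxx !orbT !andbF.
have ba : b2 != a2.
  by apply: contraNneq n1 => ->; rewrite /collinear /= !subrr !(mul0r, mulr0).
move=> /perm_mem /(_ (reflection (a1, a2) (c1, a2) (b1, b2))).
rewrite !inE eqxx !orbT reflection_horizontal //= !xpair_eqE => /esym.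
move=> H; split=> //; move: ba; case/or4P: H => /andP[_ /eqP]; lra.
Qed.

Lemma kite_vertical_axis A B C D :
  Defs.nondegenerate A B C D -> A.1 = C.1 -> B.2 = D.2 ->
  symmetric_about A C A B C D -> B.1 != D.1 /\ B.1 + D.1 = 2 * A.1.
Proof.
case: A B C D => [a1 a2] [b1 b2] [c1 c2] [d1 d2] /=.
move=> /and5P[U n1 n2 n3 _] hc hd; subst c1 d2; rewrite /symmetric_about.
have ac : a2 != c2.
  by apply: contraNneq n3 => ->; rewrite /collinear /= !subrr !(mul0r, mulr0).
have bd : b1 != d1.
  by apply: contraTneq U => ->; rewrite /= !inE eqxx !orbT !andbF.
have ba : b1 != a1.
  by apply: contraNneq n1 => ->; rewrite /collinear /= !subrr !(mul0r, mulr0).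
move=> /perm_mem /(_ (reflection (a1, a2) (a1, c2) (b1, b2))).
rewrite !inE eqxx !orbT reflection_vertical //= !xpair_eqE => /esym.
move=> H; split=> //; move: ba; case/or4P: H => /andP[/eqP + _]; lra.
Qed.

(** With [symmetric_about_rot], this cyclic relabelling turns symmetry about [BD] into symmetry
    about the first diagonal. *)
Lemma nondegenerate_rot A B C D :
  Defs.nondegenerate A B C D -> Defs.nondegenerate B C D A.
Proof.
case: A B C D => [a1 a2] [b1 b2] [c1 c2] [d1 d2] /and5P[U n1 n2 n3 n4].
have U' : uniq [:: (b1, b2); (c1, c2); (d1, d2); (a1, a2)].
  by rewrite -(rot_uniq 3).
rewrite /Defs.nondegenerate U' n4 /=; move: n1 n2 n3; rewrite /collinear /=.
by move=> n1 n2 n3; apply/and3P; split; [move: n1|move: n2|move: n3];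
  apply: contraNN => /eqP E; apply/eqP; lra.
Qed.

Lemma symmetric_about_rot X Y A B C D :
  symmetric_about X Y A B C D = symmetric_about X Y B C D A.
Proof.
rewrite /symmetric_about -[[:: B; C; D; A]]/(rot 1 [:: A; B; C; D]).
by rewrite map_rot perm_rot [RHS]perm_sym perm_rot perm_sym.
Qed.

(** The four alternatives record which diagonal is the axis and whether it is horizontal or
    vertical. *)
Lemma ax_kite_midpoint A B C D : ax_kite A B C D ->
  [\/ B.2 != D.2 /\ B.2 + D.2 = 2 * A.2, A.2 != C.2 /\ A.2 + C.2 = 2 * B.2,
      B.1 != D.1 /\ B.1 + D.1 = 2 * A.1 | A.1 != C.1 /\ A.1 + C.1 = 2 * B.1].
Proof.
move=> /andP[/andP[nd]]; have nd' := nondegenerate_rot nd.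
case/orP=> sym /orP[]/andP[/eqP e1 /eqP e2].
- by apply: Or41; apply: kite_horizontal_axis sym.
- by apply: Or43; apply: kite_vertical_axis sym.
- rewrite symmetric_about_rot in sym; apply: Or44.
  by rewrite addrC; have [] := kite_vertical_axis nd' e2 (esym e1) sym; rewrite eq_sym.
- rewrite symmetric_about_rot in sym; apply: Or42.
  by rewrite addrC; have [] := kite_horizontal_axis nd' e2 (esym e1) sym; rewrite eq_sym.
Qed.

(** The shift by one in [grid_point] is a translation, so it preserves the midpoint relation. *)
Lemma ap3_free_natr n (S : {set 'I_n}) : ap3_free S ->
  {in S & &, forall x y z : 'I_n,
     ~ (x.+1%:R != z.+1%:R :> R /\ x.+1%:R + z.+1%:R = 2 * y.+1%:R :> R)}.
Proof.
move=> fS x y z hx hy hz [/negP ne /eqP].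
rewrite -natrD -natrM eqr_nat => /eqP E; apply: ne.
by rewrite (fS x y z) //; lia.
Qed.

Lemma ap3_free_ax_kite_free n (S : {set 'I_n}) :
  ap3_free S -> ax_kite_free R (setX S S).
Proof.
move=> /ap3_free_natr fS; apply/negP.
move=> /exists_inP[a + /exists_inP[b + /exists_inP[c + /exists_inP[d + K]]]].
rewrite !inE => /andP[a1 a2] /andP[b1 b2] /andP[c1 c2] /andP[d1 d2].
by case: (ax_kite_midpoint K); apply: fS.
Qed.

Lemma sqr_card_le_f_ax_kite n (S : {set 'I_n}) :
  ap3_free S -> (#|S| ^ 2 <= f_ax_kite R n)%N.
Proof.
move=> /ap3_free_ax_kite_free fS.
by rewrite -mulnn -cardsX; apply: (@leq_bigmax_cond _ (@ax_kite_free R n)).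
Qed.

End KiteGeometry.

(** * Choice of [k] and the final estimate *)

Lemma exists_sqr_log (n : nat) : (2 <= n)%N ->
  exists k, (0 < k)%N && (2 ^ k ^ 2 <= n < 2 ^ k.+1 ^ 2)%N.
Proof.
move=> n2.
have ex1 : exists k, (2 ^ k ^ 2 <= n)%N by exists 1%N.
have bd k : (2 ^ k ^ 2 <= n)%N -> (k <= n)%N.
  apply: leq_trans; apply: leq_trans (ltnW (ltn_expl k (isT : 1 < 2)%N)) _.
  by rewrite leq_exp2l // -mulnn; case: k => // k; rewrite leq_pmull.
(* The largest admissible [k] is the integer part of the square root of the binary logarithm of [n];
   it is positive because 1 is admissible. *)
case: (ex_maxnP ex1 bd) => k hk kmax; exists k; rewrite hk kmax //= ltnNge.
by apply/negP => /kmax; rewrite ltnn.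
Qed.

Theorem proposition3p14 (R : realType) :
  exists c C : R, 0 < c /\ 0 < C /\
    exists N : nat, forall n : nat, (N <= n)%N ->
      c * n%:R ^+ 2 * expR (- C * Num.sqrt (ln n%:R)) <= (f_ax_kite R n)%:R.
Proof.
have ln2 : 0 < ln 2 :> R by rewrite ln_gt0 // ltr1n.
(* Squaring [n <= 2 ^ (6 * k + 1) * #|S|] loses the factor [4 * 2 ^ (12 * k)]. The 4 gives the first
   constant; the second absorbs the power of 2 because [k * ln 2 <= sqrt (ln 2) * sqrt (ln n)]. *)
exists 4^-1, (12 * Num.sqrt (ln 2)); split; first by rewrite invr_gt0.
split; first by rewrite mulr_gt0 // sqrtr_gt0.
exists 2%N => n n2.
have [k /andP[k0 hk]] := exists_sqr_log n2.
have [S [fS hS]] := behrend k0 hk.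
have n0 : 0 < n%:R :> R by rewrite ltr0n; lia.
have le_exp : expR (- (12 * Num.sqrt (ln 2)) * Num.sqrt (ln n%:R))
    <= (2 ^+ (12 * k))^-1 :> R.
  have lnn : k%:R ^+ 2 * ln 2 <= ln n%:R :> R.
    have pow_gt0 : 0 < 2 ^+ (k ^ 2) :> R by rewrite exprn_gt0.
    rewrite mulrC -natrX mulr_natr -lnXn // ler_ln ?posrE // -natrX ler_nat.
    by case/andP: hk.
  have : k%:R * Num.sqrt (ln 2) <= Num.sqrt (ln n%:R) :> R.
    rewrite -(ger0_norm (ler0n R k)) -sqrtr_sqr -sqrtrM ?sqr_ge0 //.
    by rewrite ler_wsqrtr.
  move=> /(ler_wpM2l (sqrtr_ge0 (ln 2))).
  rewrite mulrCA -expr2 sqr_sqrtr ?(ltW ln2) // => h.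
  rewrite mulNr expRN lef_pV2 ?posrE ?expR_gt0 ?exprn_gt0 //.
  rewrite -[2 in leLHS]lnK ?posrE // -expRM_natl ler_expR.
  by rewrite natrM; lra.
apply: (@le_trans _ _ (#|S| ^ 2)%:R); last first.
  by rewrite ler_nat sqr_card_le_f_ax_kite.
apply: le_trans (ler_wpM2l _ le_exp) _.
  by rewrite mulr_ge0 ?invr_ge0 // exprn_ge0 // ltW.
rewrite ler_pdivrMr ?exprn_gt0 // ler_pdivrMl //.
have : (n ^ 2 <= (2 ^ (6 * k + 1) * #|S|) ^ 2)%N by rewrite leq_exp2r.
rewrite -(ler_nat R) natrX => /le_trans; apply.
rewrite expnMn -expnM.
have -> : ((6 * k + 1) * 2 = 12 * k + 2)%N by lia.
by rewrite le_eqVlt expnD !natrM !natrX; apply/orP; left; apply/eqP; ring.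
Qed.
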